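(* Let $\alpha=2-\frac{2}{\sqrt3}$. For $n\ge 3$, let $\mathcal{P}_n$ denote the set of all $n$-tuples $(w_1,\dots,w_n)$ of vectors in the 3-dimensional Euclidean space $\mathbb{R}^3$ forming a polygon of perimeter 2, i.e. with $\sum_{i=1}^n w_i=0$ and $\sum_{i=1}^n|w_i|=2$. (1) For every integer $n\ge 3$ and every $(w_1,\dots,w_n)\in\mathcal{P}_n$, $$\max_{i\neq j}\bigl(|w_i|+|w_j|-|w_i+w_j|\bigr)\ \ge\ \frac{2\alpha}{n}.$$ (2) The bound is asymptotically tight: $$\lim_{n\to\infty}\ \frac{n}{2\alpha}\ \inf_{(w_1,\dots,w_n)\in\mathcal{P}_n}\ \max_{i\ne j}\bigl(|w_i|+|w_j|-|w_i+w_j|\bigr)=1.$$ (3) For $n\ge 3$ and $(w_1,\dots,w_n)\in\mathcal{P}_n$, equality holds in (1) if and only if $4\mid n$ and the multiset $\{w_1,\dots,w_n\}$ consists of four distinct vectors, each occurring exactly $n/4$ times, with endpoints forming the vertices of a regular tetrahedron centered at the origin.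
   Context: $|\cdot|$ is the Euclidean norm on $\mathbb{R}^3$. The maximum is over pairs of distinct indices $i,j\in\{1,\dots,n\}$. *)

(* Defs.v *)
From HB Require Import structures.
From mathcomp Require Import all_boot all_order all_algebra.
From mathcomp Require Import all_classical all_reals all_analysis.

Set Implicit Arguments.
Unset Strict Implicit.
Unset Printing Implicit Defensive.

Import Order.TTheory GRing.Theory Num.Theory.
Import numFieldNormedType.Exports.

Local Open Scope classical_set_scope.
Local Open Scope ring_scope.

(* MathComp-Analysis' own norm `|v| on row vectors is the sup norm, so the
   Euclidean norm is defined here. *)
Definition enorm (R : realType) (v : 'rV[R]_3) : R :=
  Num.sqrt (\sum_(k < 3) v 0 k ^+ 2).

Definition alpha (R : realType) : R := 2 - 2 / Num.sqrt 3.

Definition polygons (R : realType) (n : nat) : set ('I_n -> 'rV[R]_3) :=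
  [set w | \sum_(i < n) w i = 0 /\ \sum_(i < n) enorm (w i) = 2].
Arguments polygons : clear implicits.

(* The default value 0 is harmless: the terms are nonnegative by the triangle
   inequality, and the index set is nonempty as soon as n >= 2. *)
Definition max_defect (R : realType) (n : nat) (w : 'I_n -> 'rV[R]_3) : R :=
  \big[Num.max/0]_(p : 'I_n * 'I_n | p.1 != p.2)
    (enorm (w p.1) + enorm (w p.2) - enorm (w p.1 + w p.2)).

(* Four points with all six mutual distances equal to a common l > 0, whose
   centroid is the origin. *)
Definition centered_regular_tetrahedron (R : realType)
    (v : 'I_4 -> 'rV[R]_3) : Prop :=
  (exists2 l : R, 0 < l & forall i j, i != j -> enorm (v i - v j) = l) /\
  \sum_(i < 4) v i = 0.

(* Main.v *)
(* For weights [c >= 0] with [sum c_i w_i = 0] one shows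
   [alpha * sum c_i |w_i| <= M * sum c_i], [M] being the maximal defect; all
   weights equal to 1 give the bound. By Caratheodory's theorem in dimension
   3 + 1 one may assume that at most four weights are nonzero. Then the lower
   bounds [w_i . w_j >= |w_i||w_j| - M (|w_i| + |w_j|) + M^2 / 2], inserted in
   the rows of [Gram * c = 0], bound each [c_i |w_i|] by a concave function of
   [c_i], and its tangent at [c_i = 1/4] gives the inequality, with equality
   only for equal weights on a regular tetrahedron. In the case of equality every
   [w_i] therefore lies in such a tetrahedron, all lengths agree, and a vector
   of that length whose scalar products with the four vertices are all at least
   [- |w_i|^2 / 3] is a vertex. Asymptotic tightness comes from [n %/ 4] copies
   of a tetrahedron completed by zero vectors. *)

Require Import Defs.
From HB Require Import structures.
From mathcomp Require Import all_boot all_order all_algebra.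
From mathcomp Require Import all_classical all_reals all_analysis.
From mathcomp Require Import ring lra.

Set Implicit Arguments.
Unset Strict Implicit.
Unset Printing Implicit Defensive.

Import Order.TTheory GRing.Theory Num.Theory.
Import numFieldNormedType.Exports.

Local Open Scope classical_set_scope.
Local Open Scope ring_scope.

(** * Conic Caratheodory theorem *)

(** The vectors indexed by [S] are the rows of a matrix with more rows than columns, so its left
    kernel contains a nonzero vector. *)
Lemma dependence_of_card (F : fieldType) (n d : nat) (x : 'I_n -> 'rV[F]_d)
    (S : {set 'I_n}) : (d < #|S|)%N ->
  exists e : 'I_n -> F, [/\ \sum_i e i *: x i = 0,
    (exists i, e i != 0) & forall i, i \notin S -> e i = 0].
Proof.
move=> dS; pose A := \matrix_(k < #|S|) x (enum_val k).
have : kermx A != 0.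
  rewrite kermx_eq0 /row_free neq_ltn (leq_ltn_trans _ dS) //.
  exact: rank_leq_col.
case/rowV0Pn => u /sub_kermxP uA0 /rV0Pn[k0 uk0].
(* Extension of [u] by zero outside [S]: as [enum_val] is injective, each inner sum has at most one
   term. *)
exists (fun i => \sum_(k | enum_val k == i) u 0 k); split.
- rewrite -[RHS]uA0 mulmx_sum_row (partition_big enum_val predT) //=.
  apply: eq_bigr => i _; rewrite scaler_suml; apply: eq_bigr => k /eqP <-.
  by rewrite rowK.
- exists (enum_val k0); rewrite (big_pred1 k0) // => k.
  by rewrite /= (inj_eq enum_val_inj).
- move=> i iS; rewrite big1 // => k /eqP ki.
  by rewrite -ki enum_valP in iS.
Qed.

(** Induction on the size of the support: while it exceeds [d], a multiple of a linear dependence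
    inside the support is subtracted until a first weight vanishes. *)
Lemma conic_caratheodory (F : realFieldType) (n d : nat)
    (x : 'I_n -> 'rV[F]_d) (c : 'I_n -> F) : (forall i, 0 <= c i) ->
  exists c' : 'I_n -> F, [/\ forall i, 0 <= c' i,
    \sum_i c' i *: x i = \sum_i c i *: x i &
    (#|[set i | (c' i != 0)%R]%SET| <= d)%N].
Proof.
have [k] := ubnP #|[set i | c i != 0]%SET|; elim: k c => // k IHk c ltk c0.
have [small|big] := leqP #|[set i | c i != 0]%SET| d; first by exists c.
have [e [ex0 e_neq0 eS]] := dependence_of_card x big.
(* The sign of [e] is free; a positive entry is wanted because subtracting a positive multiple of
   [e] decreases exactly those weights. *)
wlog [i0 ei0] : e ex0 e_neq0 eS / exists i, 0 < e i => [wl|].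
  have [i ei_neq0] := e_neq0; have [ei|ei|/eqP] := ltgtP (e i) 0; first last.
  - by rewrite (negPf ei_neq0).
  - by apply: (wl e) => //; exists i.
  apply: (wl (fun i => - e i)).
  - under eq_bigr do rewrite scaleNr.
    by rewrite sumrN ex0 oppr0.
  - by exists i; rewrite oppr_eq0 lt_eqF.
  - by move=> j /eS ->; rewrite oppr0.
  - by exists i; rewrite oppr_gt0.
have [j ej jmin] : exists2 j, 0 < e j & forall i, 0 < e i -> c j / e j <= c i / e i.
  case: (arg_minP (P := [pred i | 0 < e i]) (fun i => c i / e i) ei0) => j ej jm.
  by exists j.
(* The largest multiple of [e] whose subtraction keeps all weights nonnegative; it annihilates the
   weight of [j]. *)
pose t := c j / e j; pose c1 i := c i - t * e i.
have t0 : 0 <= t by rewrite divr_ge0 // ltW.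
have c1_ge0 i : 0 <= c1 i.
  rewrite subr_ge0; have [ei|ei] := ltP 0 (e i); last first.
    by apply: le_trans (c0 i); rewrite mulr_ge0_le0.
  by rewrite -ler_pdivlMr // jmin.
have lt1 : (#|[set i | (c1 i != 0)%R]%SET| < k)%N.
  apply: leq_trans (_ : (#|[set i | (c i != 0)%R]%SET| <= k)%N); last by [].
  apply: proper_card; apply/properP; split.
    apply/fintype.subsetP => i; rewrite !inE; apply: contra => /eqP ci.
    by rewrite /c1 eS ?ci ?mulr0 ?subr0 // inE ci eqxx.
  exists j; last by rewrite inE /c1 /t divfK ?subrr ?eqxx // gt_eqF.
  by apply: contraT => jS; rewrite (eS j) // ltxx in ej.
have [c' [c'0 c'x c'S]] := IHk _ lt1 c1_ge0; exists c'; split => //.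
rewrite c'x; under eq_bigr do rewrite scalerBl -scalerA.
by rewrite sumrB -scaler_sumr ex0 scaler0 subr0.
Qed.

(** With one scalar coordinate appended to each vector, Caratheodory's theorem preserves a chosen
    linear functional of the weights besides the vector sum. *)
Lemma sum_scale_row_mx (F : pzRingType) (n d : nat) (w : 'I_n -> 'rV[F]_d)
    (b e : 'I_n -> F) :
  \sum_i e i *: row_mx (w i) (b i)%:M =
  row_mx (\sum_i e i *: w i) (\sum_i e i * b i)%:M :> 'rV_(d + 1).
Proof.
elim/big_ind3 : _ => [|u1 u2 u3 v1 v2 v3 -> ->|i _].
- by rewrite raddf0 row_mx0.
- by rewrite raddfD add_row_mx.
- by rewrite scale_row_mx scale_scalar_mx.
Qed.

(** * Scalar product *)

Section Dot.
Variable R : realType.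
Implicit Types (u v w : 'rV[R]_3) (a : R).

Definition dot u v : R := (u *m v^T) 0 0.

Lemma dotE u v : dot u v = \sum_(k < 3) u 0 k * v 0 k.
Proof. by rewrite /dot mxE; apply: eq_bigr => k _; rewrite mxE. Qed.

Lemma dotC u v : dot u v = dot v u.
Proof. by rewrite !dotE; apply: eq_bigr => k _; rewrite mulrC. Qed.

Lemma dotDl u v w : dot (u + v) w = dot u w + dot v w.
Proof. by rewrite /dot mulmxDl mxE. Qed.

Lemma dotDr u v w : dot w (u + v) = dot w u + dot w v.
Proof. by rewrite !(dotC w) dotDl. Qed.

Lemma dotZl a u v : dot (a *: u) v = a * dot u v.
Proof. by rewrite /dot -scalemxAl mxE. Qed.

Lemma dotZr a u v : dot v (a *: u) = a * dot v u.
Proof. by rewrite !(dotC v) dotZl. Qed.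

Lemma dotBl u v w : dot (u - v) w = dot u w - dot v w.
Proof. by rewrite -scaleN1r dotDl dotZl mulN1r. Qed.

Lemma dotBr u v w : dot w (u - v) = dot w u - dot w v.
Proof. by rewrite !(dotC w) dotBl. Qed.

Lemma dot_suml (I : finType) (P : pred I) (F : I -> 'rV[R]_3) v :
  dot (\sum_(i | P i) F i) v = \sum_(i | P i) dot (F i) v.
Proof. by rewrite /dot mulmx_suml summxE. Qed.

Lemma dot_sumr (I : finType) (P : pred I) (F : I -> 'rV[R]_3) v :
  dot v (\sum_(i | P i) F i) = \sum_(i | P i) dot v (F i).
Proof. by rewrite dotC dot_suml; apply: eq_bigr => i _; rewrite dotC. Qed.

Lemma enorm_ge0 v : 0 <= enorm v.
Proof. exact: sqrtr_ge0. Qed.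

Lemma dot_ge0 v : 0 <= dot v v.
Proof. by rewrite dotE sumr_ge0 // => k _; rewrite -expr2 sqr_ge0. Qed.

Lemma dot_eq0 v : dot v v = 0 -> v = 0.
Proof.
rewrite dotE => /psumr_eq0P v0; apply/rowP => k; rewrite mxE.
have := v0 (fun k _ => sqr_ge0 (v 0 k)) k isT.
by move/eqP; rewrite mulf_eq0 orbb => /eqP.
Qed.

Lemma enormE v : enorm v = Num.sqrt (dot v v).
Proof. by rewrite /enorm dotE. Qed.

Lemma enorm_sqr v : enorm v ^+ 2 = dot v v.
Proof. by rewrite enormE sqr_sqrtr // dot_ge0. Qed.

Lemma enorm_eqP v a : 0 <= a -> enorm v = a <-> dot v v = a ^+ 2.
Proof.
move=> a0; split => [<-|va]; first by rewrite enorm_sqr.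
by rewrite enormE va sqrtr_sqr ger0_norm.
Qed.

Lemma enorm0 : enorm (0 : 'rV[R]_3) = 0.
Proof. by apply/enorm_eqP => //; rewrite expr0n /dot mul0mx mxE. Qed.

Lemma dot_addE u v : dot (u + v) (u + v) = dot u u + 2 * dot u v + dot v v.
Proof. by rewrite !(dotDl, dotDr) (dotC v u); ring. Qed.

(** The squared norm of [enorm v *: u + enorm u *: v] is [2 * enorm u * enorm v] times the
    difference of the two sides; if that factor is zero, one of the vectors vanishes. *)
Lemma cauchy_schwarz_opp u v : - (enorm u * enorm v) <= dot u v.
Proof.
have [u0 v0] := (enorm_ge0 u, enorm_ge0 v).
have [uv0|uv0] := eqVneq (enorm u * enorm v) 0.
  rewrite uv0 oppr0; move/eqP: uv0; rewrite mulf_eq0.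
  by case/orP => /eqP/(enorm_eqP _ (lexx 0)); rewrite expr0n => /dot_eq0 ->;
    rewrite /dot ?trmx0 ?mulmx0 ?mul0mx mxE.
have uv_gt0 : 0 < enorm u * enorm v by rewrite lt_def uv0 mulr_ge0.
have := dot_ge0 (enorm v *: u + enorm u *: v).
rewrite dot_addE !(dotZl, dotZr) -!enorm_sqr => H.
suff : 0 <= (enorm u * enorm v) * (enorm u * enorm v + dot u v).
  by rewrite pmulr_rge0 // => ?; lra.
by nra.
Qed.

End Dot.

(** * The constant [alpha] *)

Section Alpha.
Variable R : realType.

(** This is [(2 - alpha R) ^+ 2 = 4 / 3] without denominators; with [alpha_bounds] it is all that
    the later computations use about the constant. *)
Lemma alpha_sqr : 3 * alpha R ^+ 2 = 12 * alpha R - 8.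
Proof.
rewrite /alpha; have : (Num.sqrt 3 : R) ^+ 2 = 3 by rewrite sqr_sqrtr.
have : (Num.sqrt 3 : R) != 0 by rewrite sqrtr_eq0 -ltNge.
by move: (Num.sqrt _) => s s0 s3; field: s3.
Qed.

(** The lower bound makes the coefficient [2 * a - 4 / 3] in [tangent_gap] positive, the upper one
    makes [1 - a] positive in [coef_gt0]. *)
Lemma alpha_bounds : 2 / 3 < alpha R < 1.
Proof.
have s0 : 0 < Num.sqrt 3 :> R by rewrite sqrtr_gt0.
have s3 : (Num.sqrt 3 : R) ^+ 2 = 3 by rewrite sqr_sqrtr.
have i0 : 0 < (Num.sqrt 3 : R)^-1 by rewrite invr_gt0.
have i3 : 3 * ((Num.sqrt 3 : R)^-1) ^+ 2 = 1 by rewrite exprVn s3 divff.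
by rewrite /alpha; apply/andP; split; nra.
Qed.

End Alpha.

(** * Defect and rigidity of four vectors *)

Section Defect.
Variable R : realType.
Implicit Types (u v : 'rV[R]_3) (M r : R).

(** If [M <= enorm u + enorm v], square the inequality [enorm u + enorm v - M <= enorm (u + v)].
    Otherwise [2 * enorm v <= M <= 2 * enorm u], and Cauchy-Schwarz suffices because
    [(2 * enorm u - M) * (M - 2 * enorm v)] is nonnegative. *)
Lemma dot_lower_bound u v M : enorm u + enorm v - enorm (u + v) <= M ->
  M <= 2 * enorm u ->
  enorm u * enorm v - M * (enorm u + enorm v) + M ^+ 2 / 2 <= dot u v.
Proof.
have [[u0 v0] uv0] := (enorm_ge0 u, enorm_ge0 v, enorm_ge0 (u + v)).
have := enorm_sqr (u + v); rewrite dot_addE -!enorm_sqr.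
have := cauchy_schwarz_opp u v.
move: (enorm u) (enorm v) (enorm (u + v)) (dot u v) u0 v0 uv0.
move=> a b c d a0 b0 c0 cs c2 abM Ma.
have [Mab|/ltW Mab] := leP M (a + b); last first.
  apply: le_trans cs.
  have : 0 <= (2 * a - M) * (M - 2 * b) by apply: mulr_ge0; lra.
  by nra.
have : (a + b - M) ^+ 2 <= c ^+ 2 by rewrite lerXn2r ?nnegrE ?subr_ge0 //; lra.
by rewrite c2; nra.
Qed.

Lemma defect_parallel u v r : 0 <= r -> dot u u = r ^+ 2 ->
  dot v v = r ^+ 2 -> dot u v = r ^+ 2 ->
  enorm u + enorm v - enorm (u + v) = 0.
Proof.
move=> r0 uu vv uv.
have -> : enorm u = r by apply/enorm_eqP.
have -> : enorm v = r by apply/enorm_eqP.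
suff -> : enorm (u + v) = 2 * r by ring.
by apply/enorm_eqP; [lra | rewrite dot_addE uu vv uv; ring].
Qed.

(** The origin of [alpha]: two vertices of a centered regular tetrahedron of circumradius [r] have a
    sum of length [2 * r / Num.sqrt 3], which is [(2 - alpha R) * r]. *)
Lemma defect_tetrahedral u v r : 0 <= r -> dot u u = r ^+ 2 ->
  dot v v = r ^+ 2 -> dot u v = - r ^+ 2 / 3 ->
  enorm u + enorm v - enorm (u + v) = alpha R * r.
Proof.
move=> r0 uu vv uv.
have -> : enorm u = r by apply/enorm_eqP.
have -> : enorm v = r by apply/enorm_eqP.
suff -> : enorm (u + v) = (2 - alpha R) * r by ring.
have := alpha_sqr R; have /andP[_] := alpha_bounds R => a1 a2.
apply/enorm_eqP; first by apply: mulr_ge0; lra.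
rewrite dot_addE uu vv uv.
have -> : ((2 - alpha R) * r) ^+ 2 =
  (4 - 4 * alpha R + (3 * alpha R ^+ 2) / 3) * r ^+ 2 by field.
by rewrite a2; field.
Qed.

End Defect.

(** * Normalized weights on at most four vectors, with mean length [m] and defects at most
    [alpha R * m] *)

Section Rigidity.
Variables (R : realType) (n : nat) (w : 'I_n -> 'rV[R]_3) (c : 'I_n -> R).
Variable m : R.
Local Notation a := (alpha R).
Local Notation r i := (enorm (w i)).
Local Notation S := [set i | c i != 0]%SET.
Hypothesis c_ge0 : forall i, 0 <= c i.
Hypothesis c_sum : \sum_i c i = 1.
Hypothesis cw0 : \sum_i c i *: w i = 0.
Hypothesis cardS : (#|S| <= 4)%N.
Hypothesis c_norm : \sum_i c i * r i = m.
Hypothesis m_gt0 : 0 < m.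
Hypothesis defect_le :
  forall i j, i != j -> r i + r j - enorm (w i + w j) <= a * m.

Let c_le1 i : c i <= 1.
Proof. by rewrite -c_sum (bigD1 i) //= lerDl sumr_ge0. Qed.

Let row0 i : \sum_j c j * dot (w i) (w j) = 0.
Proof.
under eq_bigr do rewrite -dotZr.
by rewrite -dot_sumr cw0 /dot trmx0 mulmx0 mxE.
Qed.

Let coef_gt0 i : 0 < m - a * m + 2 * a * m * c i.
Proof.
have /andP[a_lo a_hi] : 2 / 3 < a < 1 := alpha_bounds R.
have am : a * m < m by rewrite gtr_pMl.
have a0 : 0 < a by lra.
have : 0 <= a * m * c i by rewrite !mulr_ge0 // ltW.
by move: (c i) => x; lra.
Qed.

(* For [2 r_i < a m] the inequality comes from [m >= a m c_i]; otherwise it is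
   row [i] of the vanishing product of the Gram matrix with [c]. *)
Lemma row_bound i : r i * (m - a * m + 2 * a * m * c i) <=
  a * m ^+ 2 - (a * m) ^+ 2 * (1 - c i) / 2.
Proof.
have /andP[a_lo a_hi] : 2 / 3 < a < 1 := alpha_bounds R.
have a0 : 0 < a by lra.
have am0 : 0 < a * m by rewrite pmulr_lgt0.
have ci0 := c_ge0 i; have ci1 := c_le1 i.
have ri0 : 0 <= r i := enorm_ge0 _.
have [small|large] := ltP (2 * r i) (a * m).
  apply: (@le_trans _ _ (a * m / 2 * (m - a * m + 2 * a * m * c i))).
    by apply: ler_wpM2r; [exact/ltW/coef_gt0|lra].
  rewrite -subr_ge0.
  have -> : a * m ^+ 2 - (a * m) ^+ 2 * (1 - c i) / 2 -
    a * m / 2 * (m - a * m + 2 * a * m * c i) = a * m / 2 * (m - a * m * c i).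
    by field.
  have : a * m * c i <= a * m by rewrite ler_piMr // ltW.
  have : a * m <= m by rewrite ler_piMl // ltW.
  move=> am acm; apply: mulr_ge0; first by rewrite divr_ge0 // ltW.
  by rewrite subr_ge0 (le_trans acm).
pose b j := r i * r j - a * m * (r i + r j) + (a * m) ^+ 2 / 2.
have bE : \sum_j c j * b j = r i * m - a * m * (r i + m) + (a * m) ^+ 2 / 2.
  transitivity (\sum_j ((r i - a * m) * (c j * r j) +
     ((a * m) ^+ 2 / 2 - a * m * r i) * c j)).
    by apply: eq_bigr => j _; rewrite /b; ring.
  by rewrite big_split /= -!mulr_sumr c_sum c_norm; ring.
have : \sum_(j | j != i) c j * b j <= \sum_(j | j != i) c j * dot (w i) (w j).
  apply: ler_sum => j ji; apply: ler_wpM2l => //.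
  by apply: dot_lower_bound => //; apply: defect_le; rewrite eq_sym.
(* Once the term of index [i] is isolated in both sums, the quadratic terms [c i * r i ^+ 2] cancel
   and an inequality linear in [r i] remains. *)
have := row0 i; rewrite (bigD1 i) //= -enorm_sqr.
move: bE; rewrite (bigD1 i) //= /b.
move: (\sum_(j | _) _) (\sum_(j | _) _) => X Y; nra.
Qed.

(** The tangent line minus [c i * r i]. The line takes the value [m / 4] at [c i = 1/4], so over
    four indices whose weights sum to 1 the gaps add up to zero. *)
Let gap i := a / 2 * m * c i + m * (1 - a / 2) / 4 - c i * r i.

(* The concave function of [c i] bounding [c i * r i] lies below its tangent
   at [1/4]. *)
Lemma tangent_gap i : (2 * a - 4 / 3) * (m * (c i - 4^-1)) ^+ 2 <=
  gap i * (m - a * m + 2 * a * m * c i).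
Proof.
have a2 : 3 * a ^+ 2 = 12 * a - 8 := alpha_sqr R.
have := ler_wpM2l (c_ge0 i) (row_bound i).
rewrite -subr_ge0 -[in X in _ -> X]subr_ge0 => H; apply: le_trans H _.
(* Both sides are in fact equal: their difference is a multiple of [12 * a - 8 - 3 * a ^+ 2], which
   vanishes by [alpha_sqr]. *)
rewrite le_eqVlt; apply/orP; left; apply/eqP.
rewrite /gap; move: (c i) (r i) => x y; apply/subr0_eq.
transitivity ((12 * a - 8 - 3 * a ^+ 2) *
  (m ^+ 2 * (x ^+ 2 / 6 - x / 12 + 24^-1))); first by field.
by rewrite a2 subrr mul0r.
Qed.

Let gap_ge0 i : 0 <= gap i.
Proof.
have /andP[a_lo a_hi] : 2 / 3 < a < 1 := alpha_bounds R.
rewrite -(pmulr_lge0 _ (coef_gt0 i)); apply: le_trans (tangent_gap i).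
by apply: mulr_ge0; [lra|exact: sqr_ge0].
Qed.

Let sum_supp (f : 'I_n -> R) : \sum_(i in S) c i * f i = \sum_i c i * f i.
Proof.
rewrite [RHS](bigID (mem S)) /= [X in _ + X]big1 ?addr0 // => i.
by rewrite inE negbK => /eqP ->; rewrite mul0r.
Qed.

Let sum_supp1 : \sum_(i in S) c i = 1.
Proof.
have := sum_supp (fun=> 1); under eq_bigr do rewrite mulr1.
by under [RHS]eq_bigr do rewrite mulr1; rewrite c_sum.
Qed.

(** The gaps are nonnegative, while their sum over [S] is [m * (1 - a / 2) * (#|S| - 4) / 4], which
    is at most zero. *)
Let gap_eq0 i : i \in S -> gap i = 0.
Proof.
have /andP[a_lo a_hi] : 2 / 3 < a < 1 := alpha_bounds R.
have a2 : 0 <= 1 - a / 2 by lra.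
move: i; apply: psumr_eq0P => [i _|]; first exact: gap_ge0.
apply/eqP; rewrite eq_le sumr_ge0 ?andbT => [|i _]; last exact: gap_ge0.
rewrite sumrB big_split /= -mulr_sumr sum_supp1 sum_supp c_norm sumr_const.
rewrite -(mulr_natr _ #|S|); have : #|S|%:R <= 4 :> R by rewrite (ler_nat R _ 4).
move: #|S|%:R => k k4.
have k4' : 0 <= 4 - k by rewrite subr_ge0.
have : 0 <= m * (1 - a / 2) * (4 - k) by rewrite !mulr_ge0 // ltW.
by lra.
Qed.

Lemma rigid_weight i : i \in S -> c i = 4^-1.
Proof.
have /andP[a_lo a_hi] : 2 / 3 < a < 1 := alpha_bounds R.
move=> iS; have := tangent_gap i; rewrite gap_eq0 // mul0r.
rewrite pmulr_rle0; last by lra.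
move=> sq; have : (m * (c i - 4^-1)) ^+ 2 == 0 by rewrite eq_le sq sqr_ge0.
rewrite sqrf_eq0 mulf_eq0 gt_eqF //= subr_eq0.
by move/eqP.
Qed.

Lemma rigid_norm i : i \in S -> enorm (w i) = m.
Proof.
by move=> iS; have := gap_eq0 iS; rewrite /gap rigid_weight //; lra.
Qed.

Lemma rigid_card : #|S| = 4%N.
Proof.
have := sum_supp1; rewrite (eq_bigr (fun=> 4^-1)) => [|i iS]; last first.
  exact: rigid_weight.
rewrite sumr_const -(mulr_natr _ #|S|) => H.
have : #|S|%:R = 4 :> R by lra.
by move/eqP; rewrite eqr_nat => /eqP.
Qed.

(** With all lengths equal to [m], [dot_lower_bound] and [alpha_sqr] bound each product below by
    [- m ^+ 2 / 3]. Row [i] makes the three products with the other vectors sum to [- m ^+ 2], so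
    each bound is attained. *)
Lemma rigid_dot i j : i \in S -> j \in S -> i != j ->
  dot (w i) (w j) = - m ^+ 2 / 3.
Proof.
have /andP[a_lo a_hi] : 2 / 3 < a < 1 := alpha_bounds R.
have a2 : 3 * a ^+ 2 = 12 * a - 8 := alpha_sqr R.
move=> iS jS ij.
pose g k := dot (w i) (w k) + m ^+ 2 / 3.
suff /(_ j) : forall k, (k \in S) && (k != i) -> g k = 0.
  by rewrite jS eq_sym ij => /(_ isT); rewrite /g; lra.
apply: psumr_eq0P => [k /andP[kS ki]|].
  have := @dot_lower_bound _ (w i) (w k) (a * m); rewrite !rigid_norm //.
  have := defect_le (i := i) (j := k); rewrite !rigid_norm // eq_sym.
  move=> /(_ ki) dle /(_ dle) lb; have : a * m <= 2 * m.
    by rewrite ler_pM2r //; lra.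
  move=> {}/lb; rewrite /g -subr_ge0 => H; apply: le_trans H _.
  rewrite le_eqVlt; apply/orP; left; apply/eqP.
  apply/subr0_eq; transitivity ((12 * a - 8 - 3 * a ^+ 2) * (m ^+ 2 / 6)).
    by field.
  by rewrite a2 subrr mul0r.
have := row0 i; rewrite -sum_supp (bigD1 i) //= rigid_weight //.
rewrite -enorm_sqr rigid_norm // (eq_bigr (fun k => 4^-1 * dot (w i) (w k))).
  rewrite -mulr_sumr => H; rewrite /g big_split /= sumr_const.
  have -> : #|[pred k | (k \in S) && (k != i)]| = 3%N.
    have := rigid_card; rewrite (cardsD1 i) iS => -[<-].
    by apply: eq_card => k; rewrite !inE andbC.
  by rewrite -(mulr_natr _ 3); lra.
by move=> k /andP[kS _]; rewrite rigid_weight.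
Qed.

End Rigidity.

(** * The weighted inequality *)

Section Bound.
Variables (R : realType) (n : nat) (w : 'I_n -> 'rV[R]_3) (M : R).
Hypothesis M_ge0 : 0 <= M.
Hypothesis defect_le : forall i j, i != j ->
  enorm (w i) + enorm (w j) - enorm (w i + w j) <= M.

(** Serves both the inequality, by contradiction, and its equality case. Dividing the weights by
    their sum turns the last hypothesis into [M <= alpha R * m], so the rigidity results apply;
    equality follows since two distinct vectors of the support have defect exactly [alpha R * m]. *)
Lemma cone_rigidity (c : 'I_n -> R) : (forall i, 0 <= c i) ->
  \sum_i c i *: w i = 0 -> (#|[set i | (c i != 0)%R]%SET| <= 4)%N ->
  0 < \sum_i c i * enorm (w i) ->
  M * \sum_i c i <= alpha R * \sum_i c i * enorm (w i) ->
  exists m : R,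
    [/\ 0 < m, M = alpha R * m,
      M * \sum_i c i = alpha R * \sum_i c i * enorm (w i),
      #|[set i | c i != 0]%SET| = 4%N &
      (forall i, c i != 0 -> enorm (w i) = m) /\
      forall i j, c i != 0 -> c j != 0 -> i != j ->
        dot (w i) (w j) = - m ^+ 2 / 3].
Proof.
move=> c0 cw0 cardS P0 MP.
have /andP[a_lo _] := alpha_bounds R.
set L := \sum_i c i in MP *; set P := (\sum_i _) in P0 MP *.
have L0 : 0 < L.
  rewrite lt_def sumr_ge0 // andbT; apply/eqP => L0; move: P0.
  rewrite /P big1 ?ltxx // => i _.
  by rewrite (psumr_eq0P _ L0) ?mul0r.
pose d i := c i / L; pose m := P / L.
have dS : [set i | d i != 0]%SET = [set i | c i != 0]%SET.
  by apply/setP => i; rewrite !inE mulf_eq0 invr_eq0 (gt_eqF L0) orbF.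
have d0 i : 0 <= d i by rewrite divr_ge0 // ltW.
have d1 : \sum_i d i = 1 by rewrite -mulr_suml divff // gt_eqF.
have dw0 : \sum_i d i *: w i = 0.
  transitivity (L^-1 *: \sum_i c i *: w i); last by rewrite cw0 scaler0.
  by rewrite scaler_sumr; apply: eq_bigr => i _; rewrite scalerA mulrC.
have cardd : (#|[set i | (d i != 0)%R]%SET| <= 4)%N by rewrite dS.
have dm : \sum_i d i * enorm (w i) = m.
  by rewrite /m /P mulr_suml; apply: eq_bigr => i _; rewrite /d mulrAC.
have m0 : 0 < m by rewrite divr_gt0.
have Mm : M <= alpha R * m by rewrite mulrA ler_pdivlMr.
have dle i j : i != j ->
    enorm (w i) + enorm (w j) - enorm (w i + w j) <= alpha R * m.
  by move=> /defect_le H; apply: le_trans Mm.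
have Sd i : c i != 0 -> i \in [set i | d i != 0]%SET by rewrite dS inE.
have rn i : c i != 0 -> enorm (w i) = m.
  by move=> /Sd; apply: rigid_norm.
have rd i j : c i != 0 -> c j != 0 -> i != j -> dot (w i) (w j) = - m ^+ 2 / 3.
  by move=> /Sd iS /Sd jS; apply: (rigid_dot d0 d1).
have card4 : #|[set i | c i != 0]%SET| = 4%N.
  by rewrite -dS; apply: (rigid_card d0 d1 dw0 cardd dm m0).
have aM : M = alpha R * m.
  apply/eqP; rewrite eq_le Mm /=.
  have /card_gt1P[i [j [/[!inE] iS jS ij]]] :
    (1 < #|[set i | (c i != 0)%R]%SET|)%N by rewrite card4.
  apply: le_trans (defect_le ij).
  rewrite (@defect_tetrahedral _ _ _ m) ?(ltW m0) -?enorm_sqr ?rn //.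
  exact: rd.
exists m; split=> //.
by rewrite aM /m mulrA divfK // gt_eqF.
Qed.

(** The coordinate [M - alpha R * enorm (w i)] appended to [w i] makes the reduction to four weights
    preserve the difference of the two sides. A strict violation thus survives the reduction, where
    [cone_rigidity] turns it into an equality. *)
Lemma weighted_bound (c : 'I_n -> R) : (forall i, 0 <= c i) ->
  \sum_i c i *: w i = 0 ->
  alpha R * \sum_i c i * enorm (w i) <= M * \sum_i c i.
Proof.
move=> c0 cw0; rewrite leNgt; apply/negP => neg.
have /andP[a_lo _] := alpha_bounds R.
pose x i := row_mx (w i) (M - alpha R * enorm (w i))%:M : 'rV_(3 + 1).
have bE (e : 'I_n -> R) : \sum_i e i * (M - alpha R * enorm (w i)) =
    M * \sum_i e i - alpha R * \sum_i e i * enorm (w i).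
  by rewrite !mulr_sumr -sumrB; apply: eq_bigr => i _; ring.
have [c' [c'0 c'x cardc']] := conic_caratheodory x c0.
move: c'x; rewrite !sum_scale_row_mx !bE => /eq_row_mx[].
rewrite cw0 => c'w0 /matrixP/(_ 0 0); rewrite !mxE eqxx !mulr1n => cE.
have neg' : M * (\sum_i c' i) < alpha R * \sum_i c' i * enorm (w i) by lra.
have P0 : 0 < \sum_i c' i * enorm (w i).
  have a0 : 0 < alpha R by lra.
  rewrite -(pmulr_rgt0 _ a0); apply: le_lt_trans neg'.
  by rewrite mulr_ge0 // sumr_ge0.
have [m [_ _ E _ _]] := cone_rigidity c'0 c'w0 cardc' P0 (ltW neg').
by rewrite E ltxx in neg'.
Qed.

End Bound.

(** * Regular tetrahedra *)

Section Tetrahedron.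
Variable R : realType.
Implicit Types (v : 'I_4 -> 'rV[R]_3) (r : R).

(** The Gram matrix of a centered regular tetrahedron of circumradius [r]. For positive [r] it
    characterizes these, by [tetrahedral_centered] and [centered_tetrahedral]. *)
Definition tetrahedral r v := forall i j,
  dot (v i) (v j) = if i == j then r ^+ 2 else - r ^+ 2 / 3.

Lemma tetrahedral_dot_sum r v : tetrahedral r v ->
  forall i, dot (v i) (\sum_j v j) = 0.
Proof.
move=> vr i; rewrite dot_sumr (bigD1 i) //= vr eqxx.
rewrite (eq_bigr (fun=> - r ^+ 2 / 3)) => [|j ji]; last first.
  by rewrite vr eq_sym (negPf ji).
rewrite sumr_const -(mulr_natr _ #|_|).
have -> : #|[pred j | j != i]| = 3%N by rewrite cardC1 card_ord.
by field.
Qed.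

Lemma tetrahedral_sum r v : tetrahedral r v -> \sum_i v i = 0.
Proof.
move=> /tetrahedral_dot_sum vr; apply: dot_eq0.
by rewrite dot_suml big1.
Qed.

Lemma tetrahedral_neq r v i j : 0 < r -> tetrahedral r v ->
  dot (v i) (v j) = r ^+ 2 -> i = j.
Proof.
move=> r0 vr; rewrite vr; case: eqP => // _ H.
by exfalso; have := exprn_gt0 2 r0; lra.
Qed.

Lemma tetrahedral_inj r v : 0 < r -> tetrahedral r v -> injective v.
Proof.
move=> r0 vr i j vij; apply: (tetrahedral_neq r0 vr).
by rewrite vij vr eqxx.
Qed.

Lemma dot_subE (x y : 'rV[R]_3) :
  dot (x - y) (x - y) = dot x x - 2 * dot x y + dot y y.
Proof. by rewrite !(dotBl, dotBr) (dotC y x); ring. Qed.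

Lemma tetrahedral_centered r v : 0 < r -> tetrahedral r v ->
  centered_regular_tetrahedron v.
Proof.
move=> r0 vr; split; last exact: tetrahedral_sum vr.
have r2 : 0 < 8 / 3 * r ^+ 2 by rewrite mulr_gt0 // exprn_gt0.
(* The edge length: its square is [2 * r ^+ 2 + 2 / 3 * r ^+ 2]. *)
exists (Num.sqrt (8 / 3 * r ^+ 2)) => [|i j ij]; first by rewrite sqrtr_gt0.
rewrite enormE dot_subE !vr !eqxx (negPf ij); congr Num.sqrt.
by field.
Qed.

(** Summing the squared distances from one vertex, the cross terms vanish as the centroid is the
    origin. This shows that all lengths agree and fixes them in terms of [l]; the squared distances
    then give the scalar products. *)
Lemma centered_tetrahedral v : centered_regular_tetrahedron v ->
  exists2 r, 0 < r & tetrahedral r v.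
Proof.
move=> [[l l0 vl] v0].
have sq i j : dot (v i) (v i) - 2 * dot (v i) (v j) + dot (v j) (v j) =
    if i == j then 0 else l ^+ 2.
  rewrite -dot_subE; case: eqVneq => [->|ij]; last by rewrite -enorm_sqr vl.
  by rewrite subrr /dot mul0mx mxE.
have row i : 4 * dot (v i) (v i) + \sum_j dot (v j) (v j) = 3 * l ^+ 2.
  transitivity (\sum_j (if i == j then 0 else l ^+ 2)); last first.
    rewrite (bigD1 i) //= eqxx add0r (eq_bigr (fun=> l ^+ 2)) => [|j ji].
      by rewrite sumr_const cardC1 card_ord mulr_natl.
    by rewrite eq_sym (negPf ji).
  under [RHS]eq_bigr do rewrite -sq.
  have d0 : \sum_j 2 * dot (v i) (v j) = 0.
    by rewrite -mulr_sumr -dot_sumr v0 /dot trmx0 mulmx0 mxE mulr0.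
  rewrite big_split sumrB /= d0 subr0 sumr_const card_ord.
  by rewrite (mulr_natl _ 4).
pose s := dot (v ord0) (v ord0).
have vs i : dot (v i) (v i) = s by have := row i; have := row ord0; rewrite /s; lra.
have sl : s = 3 / 8 * l ^+ 2.
  have := row ord0; rewrite vs (eq_bigr (fun=> s)) // sumr_const card_ord.
  by rewrite -(mulr_natl _ 4); lra.
have s0 : 0 < s by rewrite sl mulr_gt0 ?exprn_gt0.
exists (Num.sqrt s); first by rewrite sqrtr_gt0.
move=> i j; rewrite sqr_sqrtr ?(ltW s0) //.
have := sq i j; rewrite !vs; case: eqVneq => [-> _|_]; first exact: vs.
by move: sl; lra.
Qed.

(** The vertices form a tight frame. The first three are a basis whose Gram matrix has an explicit
    inverse, which expresses [dot u u] through three products; the fourth product is minus their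
    sum. *)
Lemma tetrahedral_frame r v u : 0 < r -> tetrahedral r v ->
  \sum_k dot u (v k) ^+ 2 = 4 / 3 * r ^+ 2 * dot u u.
Proof.
move=> r0 vr; have r_neq0 : r != 0 by rewrite gt_eqF.
pose A : 'M[R]_3 := \matrix_k v (lift ord_max k).
pose p k := dot u (v k).
have psum : \sum_k p k = 0.
  by rewrite -dot_sumr (tetrahedral_sum vr) /dot trmx0 mulmx0 mxE.
(* The inverse of the Gram matrix [A *m A^T]. *)
pose N : 'M[R]_3 := (3 / 4 / r ^+ 2) *: (1%:M + const_mx 1).
have AAt : A *m A^T = r ^+ 2 *: ((4 / 3)%:M - const_mx (1 / 3)).
  apply/matrixP => i j; rewrite !mxE.
  transitivity (dot (v (lift ord_max i)) (v (lift ord_max j))).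
    by rewrite dotE; apply: eq_bigr => k _; rewrite !mxE.
  by rewrite vr (inj_eq lift_inj); case: eqP => _; rewrite ?mulr1n ?mulr0n; field.
have AAtN : A *m (A^T *m N) = 1%:M.
  rewrite mulmxA AAt -scalemxAl -scalemxAr scalerA.
  have -> : r ^+ 2 * (3 / 4 / r ^+ 2) = 3 / 4 by field.
  rewrite mulmxDr mulmx1 mulmxBl mul_scalar_mx.
  apply/matrixP => i j; rewrite !mxE.
  under eq_bigr do rewrite !mxE mulr1.
  rewrite sumr_const card_ord -(mulr_natr _ 3).
  by case: eqP => _; rewrite ?mulr1n ?mulr0n; field.
have uA k : (u *m A^T) 0 k = p (lift ord_max k).
  by rewrite /p dotE mxE; apply: eq_bigr => j _; rewrite !mxE.
have : dot u u = (u *m A^T *m N *m (u *m A^T)^T) 0 0.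
  rewrite trmx_mul trmxK !mulmxA -(mulmxA u) -(mulmxA u) (mulmx1C AAtN).
  by rewrite mulmx1.
rewrite -scalemxAr mulmxDr mulmx1 -scalemxAl mulmxDl.
have e1 : (u *m A^T *m (u *m A^T)^T) 0 0 = \sum_k p (lift ord_max k) ^+ 2.
  by rewrite mxE; apply: eq_bigr => k _; rewrite [(_^T) _ _]mxE uA expr2.
have e2 : (u *m A^T *m const_mx 1 *m (u *m A^T)^T) 0 0 =
    (\sum_k p (lift ord_max k)) ^+ 2.
  rewrite mxE expr2 mulr_sumr; apply: eq_bigr => k _.
  rewrite [(_^T) _ _]mxE uA mxE; congr (_ * _); apply: eq_bigr => j _.
  by rewrite uA mxE mulr1.
have split4 (F : 'I_4 -> R) :
    \sum_k F k = \sum_k F (lift ord_max k) + F ord_max.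
  rewrite big_ord_recr; congr (_ + _); apply: eq_bigr => k _; congr F.
  by apply: val_inj; rewrite /= /bump leqNgt ltn_ord.
rewrite mxE mxE e1 e2 split4 -/(p _) => ->.
move: psum; rewrite split4; move: (\sum_k p _) => s sp.
have -> : s = - p ord_max by lra.
by field.
Qed.

(* The four nonnegative numbers [dot u (v k) + r^2 / 3] have sum [4 r^2 / 3],
   and by [tetrahedral_frame] the sum of their squares is the square of it;
   hence only one of them is nonzero. *)
Lemma tetrahedral_extremal r v u : 0 < r -> tetrahedral r v ->
  dot u u = r ^+ 2 -> (forall k, - r ^+ 2 / 3 <= dot u (v k)) ->
  exists k, u = v k.
Proof.
move=> r0 vr uu uv; pose b k := dot u (v k) + r ^+ 2 / 3.
have r2 := exprn_gt0 2 r0.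
have b0 k : 0 <= b k by have := uv k; rewrite /b; lra.
have psum : \sum_k dot u (v k) = 0.
  by rewrite -dot_sumr (tetrahedral_sum vr) /dot trmx0 mulmx0 mxE.
have bsum : \sum_k b k = 4 / 3 * r ^+ 2.
  by rewrite big_split /= psum sumr_const card_ord -(mulr_natr _ 4); field.
have b2 : \sum_k b k * (4 / 3 * r ^+ 2 - b k) = 0.
  transitivity (\sum_k (2 / 3 * r ^+ 2 * dot u (v k) +
    (r ^+ 2 * r ^+ 2 / 3 - dot u (v k) ^+ 2))).
    by apply: eq_bigr => k _; rewrite /b; field.
  rewrite big_split sumrB /= -mulr_sumr psum (tetrahedral_frame u r0 vr) uu.
  by rewrite sumr_const card_ord -(mulr_natr _ 4); field.
have bterm k : b k * (4 / 3 * r ^+ 2 - b k) = 0.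
  move: k isT; apply: (psumr_eq0P _ b2) => k _; rewrite mulr_ge0 // subr_ge0.
  by rewrite -bsum (bigD1 k) //= lerDl sumr_ge0.
have [k bk] : exists k, b k != 0.
  apply/existsP; apply: contraT => /existsPn bn.
  by move: bsum; rewrite big1 => [|k _]; [lra | apply/eqP/negPn/bn].
(* A nonzero [b k] equals [4 / 3 * r ^+ 2], so [dot u (v k) = r ^+ 2] and [u - v k] has norm
   zero. *)
exists k; apply/subr0_eq/dot_eq0; rewrite dot_subE uu vr eqxx.
have /eqP := bterm k; rewrite mulf_eq0 (negPf bk) /= => /eqP.
by rewrite /b; lra.
Qed.

Lemma tetrahedral_defect r v k l : 0 <= r -> tetrahedral r v ->
  enorm (v k) + enorm (v l) - enorm (v k + v l) <= alpha R * r.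
Proof.
move=> r0 vr; have /andP[a_lo _] := alpha_bounds R.
have [->|kl] := eqVneq k l.
  rewrite (@defect_parallel _ _ _ r) ?vr ?eqxx //.
  by rewrite mulr_ge0 //; lra.
by rewrite (@defect_tetrahedral _ _ _ r) ?vr ?eqxx // (negPf kl).
Qed.

(** Alternate vertices of a cube: [(1,1,1)], [(1,-1,-1)], [(-1,1,-1)], [(-1,-1,1)], scaled to length
    [r] when [r] is nonnegative. *)
Definition tetrahedron r (k : 'I_4) : 'rV[R]_3 :=
  \row_j (if ((k : nat) == 0) || (k == j.+1 :> nat) then r / Num.sqrt 3
          else - (r / Num.sqrt 3)).

Lemma tetrahedral_tetrahedron r : tetrahedral r (tetrahedron r).
Proof.
move=> k l; have : (r / Num.sqrt 3) ^+ 2 = r ^+ 2 / 3.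
  by rewrite expr_div_n sqr_sqrtr.
rewrite dotE !big_ord_recl big_ord0 !mxE; move: (r / Num.sqrt 3) => s s2.
case: k l => [[|[|[|[|//]]]] hk] [[|[|[|[|//]]]] hl] /=; lra.
Qed.

End Tetrahedron.

(** * Polygons *)

Section MaxDefect.
Variables (R : realType) (n : nat).
Implicit Types w : 'I_n -> 'rV[R]_3.

Lemma max_defect_ge w i j : i != j ->
  enorm (w i) + enorm (w j) - enorm (w i + w j) <= max_defect w.
Proof.
move=> ij; rewrite /max_defect.
exact: (@le_bigmax_cond _ _ _ _ (i, j) (fun p : 'I_n * 'I_n => p.1 != p.2)
  (fun p => enorm (w p.1) + enorm (w p.2) - enorm (w p.1 + w p.2))).
Qed.

Lemma max_defect_le w M : 0 <= M -> (forall i j, i != j ->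
    enorm (w i) + enorm (w j) - enorm (w i + w j) <= M) -> max_defect w <= M.
Proof. by move=> M0 wM; apply: bigmax_le => // -[i j] /= /wM. Qed.

Lemma max_defect_ge0 w : 0 <= max_defect w.
Proof. exact: bigmax_ge_id. Qed.

Lemma max_defect_lower_bound w : (3 <= n)%N -> polygons R n w ->
  2 * alpha R / n%:R <= max_defect w.
Proof.
move=> n3 [w0 w2]; have n0 : 0 < n%:R :> R by rewrite ltr0n (leq_trans _ n3).
have := weighted_bound (max_defect_ge0 w) (@max_defect_ge w)
  (c := fun=> 1) (fun=> ler01).
under eq_bigr do rewrite scale1r.
under [X in alpha R * X]eq_bigr do rewrite mul1r.
by rewrite w0 w2 sumr_const card_ord ler_pdivrMr // (mulrC 2); apply.
Qed.

(** The appended coordinate is the indicator of [i0], so the reduced weights still give [i0] weight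
    1. They satisfy the hypothesis of [cone_rigidity] because constant weights attain equality and
    the complementary weights [t - c i] obey [weighted_bound]. *)
Lemma extremal_tetrahedron_through w : (3 <= n)%N -> polygons R n w ->
  max_defect w = 2 * alpha R / n%:R -> forall i0,
  enorm (w i0) = 2 / n%:R /\
  exists f : 'I_4 -> 'I_n, tetrahedral (2 / n%:R) (w \o f).
Proof.
move=> n3 [w0 w2] wM i0.
have n0 : 0 < n%:R :> R by rewrite ltr0n (leq_trans _ n3).
have /andP[a_lo _] := alpha_bounds R; have a0 : 0 < alpha R by lra.
pose x i := row_mx (w i) (i == i0)%:R%:M : 'rV[R]_(3 + 1).
have xE (e : 'I_n -> R) : \sum_i e i *: x i =
    row_mx (\sum_i e i *: w i) (e i0)%:M.
  rewrite sum_scale_row_mx; congr (row_mx _ _%:M).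
  rewrite (bigD1 i0) //= eqxx mulr1 big1 ?addr0 // => i /negPf ->.
  by rewrite mulr0.
have [c [c0 cx cardc]] := conic_caratheodory x (c := fun=> 1) (fun=> ler01).
move: cx; rewrite !xE => /eq_row_mx[]; under [RHS]eq_bigr do rewrite scale1r.
rewrite w0 => cw0 /matrixP/(_ 0 0).
rewrite !mxE eqxx !mulr1n => ci0.
have wb := weighted_bound (max_defect_ge0 w) (@max_defect_ge w).
(* A constant exceeding every [c i], so that the complementary weights are nonnegative. *)
pose t := 1 + \sum_i c i; have t0 : 0 < t.
  by rewrite ltr_pwDl // sumr_ge0.
have tc0 i : 0 <= t - c i.
  by rewrite subr_ge0 /t (bigD1 i) //= addrCA lerDl addr_ge0 // sumr_ge0.
have tcw0 : \sum_i (t - c i) *: w i = 0.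
  under eq_bigr do rewrite scalerBl.
  by rewrite sumrB -scaler_sumr w0 cw0 scaler0 subr0.
have := wb _ tc0 tcw0.
under eq_bigr do rewrite mulrBl.
rewrite !sumrB -mulr_sumr w2 sumr_const card_ord -(mulr_natr t).
set C := \sum_i c i; set P := \sum_i _ => tCP.
have MC : max_defect w * C <= alpha R * P.
  have : max_defect w * (t * n%:R) = alpha R * (t * 2).
    by rewrite wM; field; rewrite gt_eqF.
  by lra.
have P0 : 0 < P.
  rewrite -(pmulr_rgt0 _ a0); apply: lt_le_trans MC.
  rewrite mulr_gt0 //; first by rewrite wM !(divr_gt0, mulr_gt0).
  by rewrite /C (bigD1 i0) //= ci0 ltr_pwDl // sumr_ge0.
have [m [m0 Mm _ card4 [rn rd]]] :=
  cone_rigidity (@max_defect_ge w) c0 cw0 cardc P0 MC.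
have mE : m = 2 / n%:R.
  apply: (mulfI (lt0r_neq0 a0)); rewrite -Mm wM; ring.
rewrite -mE; split; first by apply: rn; rewrite ci0 oner_neq0.
pose f k := enum_val (cast_ord (esym card4) k); exists f.
have fS k : c (f k) != 0 by have := enum_valP (cast_ord (esym card4) k); rewrite inE.
move=> k l /=; have [<-|kl] := eqVneq k l; first by rewrite -enorm_sqr rn.
by rewrite rd // (inj_eq enum_val_inj) (inj_eq (@cast_ord_inj _ _ _)).
Qed.

(** One tetrahedron is fixed; each [w i] has its circumradius as length and products at least
    [- r ^+ 2 / 3] with its vertices, hence is a vertex. Pairing [\sum_i w i = 0] with [v k] then
    yields the multiplicity of [v k]. *)
Lemma extremal_polygon w : (3 <= n)%N -> polygons R n w ->
  max_defect w = 2 * alpha R / n%:R ->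
  (4 %| n)%N /\
  exists v : 'I_4 -> 'rV[R]_3,
    [/\ injective v, centered_regular_tetrahedron v,
      (forall i : 'I_n, exists k : 'I_4, w i = v k) &
      (forall k : 'I_4, #|[set i : 'I_n | w i == v k]%SET| = (n %/ 4)%N)].
Proof.
move=> n3 wP wM; have ext := extremal_tetrahedron_through n3 wP wM.
have n0 : 0 < n%:R :> R by rewrite ltr0n (leq_trans _ n3).
set r := 2 / n%:R in ext; have r0 : 0 < r by rewrite divr_gt0.
have r2 := exprn_gt0 2 r0.
have rn i : enorm (w i) = r by have [] := ext i.
have [_ [f vr]] := ext (Ordinal (@leq_trans 3 1 n isT n3)); set v := w \o f in vr.
have /andP[a_lo a_hi] := alpha_bounds R; have a2 := alpha_sqr R.
have Mr : max_defect w = alpha R * r by rewrite wM /r; ring.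
have wv i : exists k, w i = v k.
  apply: (tetrahedral_extremal r0 vr); first by rewrite -enorm_sqr rn.
  move=> k; rewrite /v /=; have [->|ik] := eqVneq i (f k).
    by rewrite -enorm_sqr rn; lra.
  have := dot_lower_bound (max_defect_ge w ik); rewrite Mr !rn.
  have ar : alpha R * r <= 2 * r by rewrite ler_pM2r //; lra.
  move/(_ ar); rewrite -subr_ge0 => H; rewrite -subr_ge0; apply: le_trans H _.
  rewrite le_eqVlt; apply/orP; left; apply/eqP/subr0_eq.
  transitivity ((12 * alpha R - 8 - 3 * alpha R ^+ 2) * (r ^+ 2 / 6)).
    by field.
  by rewrite a2 subrr mul0r.
have cnt k : (4 * #|[set i : 'I_n | w i == v k]%SET|)%N = n.
  have [w0 _] := wP.
  have : \sum_i dot (w i) (v k) = 0 by rewrite -dot_suml w0 /dot mul0mx mxE.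
  (* The product with [v k] is [r ^+ 2] for copies of [v k] and [- r ^+ 2 / 3] otherwise. *)
  rewrite (eq_bigr (fun i => - r ^+ 2 / 3 + (w i == v k)%:R * (4 / 3 * r ^+ 2))).
    rewrite big_split /= sumr_const card_ord -mulr_suml.
    have -> : \sum_i (w i == v k)%:R =
        #|[set i : 'I_n | w i == v k]%SET|%:R :> R.
      rewrite -sum1dep_card natr_sum [RHS]big_mkcond.
      by apply: eq_bigr => i _; case: eqP.
    rewrite -[X in X + _]mulr_natl => H.
    apply/eqP; rewrite -(eqr_nat R) natrM.
    have : (4 * #|[set i : 'I_n | w i == v k]%SET|%:R - n%:R) * r ^+ 2 = 0 :> R.
      by lra.
    by move/eqP; rewrite mulf_eq0 (gt_eqF r2) orbF subr_eq0.
  move=> i _; have [l ->] := wv i; rewrite (inj_eq (tetrahedral_inj r0 vr)) vr.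
  by case: eqP => _; rewrite ?mul1r ?mul0r; field.
split; first by rewrite -(cnt ord0) dvdn_mulr.
exists v; split => //.
- exact: tetrahedral_inj r0 vr.
- exact: tetrahedral_centered r0 vr.
- by move=> k; have := congr1 (divn^~ 4) (cnt k); rewrite /= mulKn.
Qed.

(** Zero vectors have defect zero with any vector; they are allowed here to cover the padded
    polygons of [near_extremal_polygon]. *)
Lemma max_defect_tetrahedral w r v : 0 <= r -> tetrahedral r v ->
  (forall i, w i = 0 \/ exists k, w i = v k) -> max_defect w <= alpha R * r.
Proof.
move=> r0 vr wv; have /andP[a_lo _] := alpha_bounds R.
have ar0 : 0 <= alpha R * r by rewrite mulr_ge0 //; lra.
apply: max_defect_le => // i j _.
case: (wv i) (wv j) => [->|[k ->]] [->|[l ->]];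
  rewrite ?(enorm0, addr0, add0r, oppr0, subrr) //.
exact: tetrahedral_defect.
Qed.

(** All lengths equal the circumradius [r], so the perimeter gives [r * n%:R = 2] and the upper
    bound [alpha R * r] meets the lower one. *)
Lemma tetrahedral_polygon w (v : 'I_4 -> 'rV[R]_3) : (3 <= n)%N ->
  polygons R n w -> centered_regular_tetrahedron v ->
  (forall i, exists k, w i = v k) -> max_defect w = 2 * alpha R / n%:R.
Proof.
move=> n3 wP /centered_tetrahedral[r r0 vr] wv.
have n0 : n%:R != 0 :> R by rewrite pnatr_eq0 -lt0n (leq_trans _ n3).
apply/eqP; rewrite eq_le max_defect_lower_bound // andbT.
have [_] := wP; rewrite (eq_bigr (fun=> r)) => [|i _].
  rewrite sumr_const card_ord -(mulr_natr r) => rn.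
  have -> : 2 * alpha R / n%:R = alpha R * r by rewrite -rn; field.
  by apply: (max_defect_tetrahedral (ltW r0) vr) => i; right.
by have [k ->] := wv i; apply/(enorm_eqP _ (ltW r0)); rewrite vr eqxx.
Qed.

End MaxDefect.

(** * Nearly extremal polygons *)

Section Construction.
Variable R : realType.

Lemma sum_mod4 (V : zmodType) (F : nat -> V) q :
  \sum_(0 <= i < 4 * q) F (i %% 4)%N = (\sum_(0 <= k < 4) F k) *+ q.
Proof.
elim: q => [|q IHq]; first by rewrite muln0 big_geq.
rewrite (@big_cat_nat _ _ _ (4 * q)) ?leq_mul //= IHq mulrS addrC; congr (_ + _).
have := big_addn 0 (4 * q.+1) (4 * q) xpredT (fun i => F (i %% 4)%N).
rewrite add0n => ->; rewrite mulnS addnK.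
rewrite big_nat [RHS]big_nat; apply: eq_bigr => i /andP[_ i4].
by rewrite addnC mulnC modnMDl modn_small.
Qed.

Lemma sum_prefix_mod4 (V : zmodType) (F : nat -> V) n :
  \sum_(i < n) (if (i < 4 * (n %/ 4))%N then F (i %% 4)%N else 0) =
  (\sum_(0 <= k < 4) F k) *+ (n %/ 4).
Proof.
rewrite -(big_mkord xpredT
  (fun i => if (i < 4 * (n %/ 4))%N then F (i %% 4)%N else 0)).
rewrite (@big_cat_nat _ _ _ (4 * (n %/ 4))) //=; last by rewrite mulnC leq_divM.
rewrite -sum_mod4 [X in _ + X]big_nat [X in _ + X]big1 ?addr0; last first.
  by move=> i /andP[+ _]; rewrite leqNgt => /negPf ->.
by rewrite big_nat [RHS]big_nat; apply: eq_bigr => i /andP[_ ->].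
Qed.

Lemma near_extremal_polygon n : (4 <= n)%N ->
  exists2 w : 'I_n -> 'rV[R]_3, polygons R n w &
    max_defect w <= 2 * alpha R / (4 * (n %/ 4))%:R.
Proof.
move=> n4; have q0 : (n %/ 4)%:R != 0 :> R by rewrite pnatr_eq0 -lt0n divn_gt0.
(* The circumradius for which [4 * (n %/ 4)] vectors of this length have total length 2. *)
pose r : R := 2 / (4 * (n %/ 4))%:R; have r0 : 0 <= r by rewrite divr_ge0.
pose v := tetrahedron r; have vr : tetrahedral r v := tetrahedral_tetrahedron r.
pose w (i : 'I_n) : 'rV[R]_3 :=
  if (i < 4 * (n %/ 4))%N then v (inord (i %% 4)) else 0.
exists w; last first.
  have -> : 2 * alpha R / (4 * (n %/ 4))%:R = alpha R * r by rewrite /r; ring.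
  apply: (max_defect_tetrahedral r0 vr) => i; rewrite /w.
  by case: ifP => _; [right; exists (inord (i %% 4)) | left].
split.
  rewrite /w (sum_prefix_mod4 (fun k => v (inord k))) big_mkord.
  rewrite (eq_bigr v) => [|k _]; last by rewrite inord_val.
  by rewrite (tetrahedral_sum vr) mul0rn.
transitivity (\sum_(i < n) if (i < 4 * (n %/ 4))%N then r else 0).
  apply: eq_bigr => i _; rewrite /w; case: ifP => _; last exact: enorm0.
  by apply/(enorm_eqP _ r0); rewrite vr eqxx.
rewrite (sum_prefix_mod4 (fun=> r)) sumr_const_nat subn0 -mulrnA.
by rewrite -(mulr_natr r) /r divfK // natrM mulf_neq0 // pnatr_eq0.
Qed.

Lemma inf_max_defect_cvg :
  (fun n : nat => n%:R / (2 * alpha R) *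
     inf [set max_defect w | w in polygons R n]) @ \oo --> (1 : R).
Proof.
have /andP[a_lo _] := alpha_bounds R; have a0 : 0 < alpha R by lra.
(* With [q = 4 * (n %/ 4)], at least [n - 3], the sequence lies between 1 and [n / q]; [harmonic n]
   is [1 / (n + 1)]. *)
apply: (@squeeze_cvgr _ _ _ _ (cst 1) (fun n => 1 + 6 * harmonic n)).
(* From 7 on, [3 * (n + 1) <= 6 * (n - 3)], which gives [n / q <= 1 + 6 / (n + 1)]. *)
- near=> n; have n7 : (7 <= n)%N by near: n; exact: nbhs_infty_ge.
  have n3 : (3 <= n)%N by apply: leq_trans n7.
  have n0 : 0 < n%:R :> R by rewrite ltr0n (leq_trans _ n3).
  have [w wP wM] := near_extremal_polygon (leq_trans (isT : 4 <= 7)%N n7).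
  have lb : lbound [set max_defect w | w in polygons R n] (2 * alpha R / n%:R).
    by move=> _ [u uP <-]; apply: max_defect_lower_bound.
  have inv : n%:R / (2 * alpha R) * (2 * alpha R / n%:R) = 1.
    by field; rewrite !gt_eqF.
  have na0 : 0 <= n%:R / (2 * alpha R) by rewrite divr_ge0 // mulr_ge0 // ltW.
  apply/andP; split.
    rewrite -[leLHS]inv ler_wpM2l // lb_le_inf //.
    by exists (max_defect w), w.
  set q : R := (4 * (n %/ 4))%:R in wM.
  have nq : n%:R <= q + 3.
    rewrite /q -(natrD R _ 3) ler_nat {1}(divn_eq n 4) mulnC leq_add2l.
    by rewrite -ltnS ltn_pmod.
  have n7' : 7 <= n%:R :> R by rewrite (ler_nat R 7).
  apply: (@le_trans _ _ (n%:R / (2 * alpha R) * (2 * alpha R / q))).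
    rewrite ler_wpM2l //; apply: le_trans wM.
    by apply: ge_inf; [exists (2 * alpha R / n%:R) | exists w].
  move: q nq {wM} => q nq; have q0 : 0 < q by lra.
  have -> : n%:R / (2 * alpha R) * (2 * alpha R / q) = n%:R / q.
    by field; rewrite !gt_eqF.
  rewrite ler_pdivrMr // /harmonic /= -(natr1 n).
  have N0 : 0 < n%:R + 1 :> R by lra.
  rewrite -subr_ge0.
  have -> : (1 + 6 * (n%:R + 1)^-1) * q - n%:R =
    ((q - n%:R) * (n%:R + 1) + 6 * q) / (n%:R + 1).
    by field; rewrite gt_eqF.
  apply: divr_ge0 (ltW N0).
  have : 0 <= (q + 3 - n%:R) * (n%:R + 1) by rewrite mulr_ge0 ?subr_ge0 ?(ltW N0).
  by lra.
- exact: cvg_cst.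
- rewrite -[X in _ --> X]addr0 -[X in _ + X](mulr0 6).
  apply: cvgD; first exact: cvg_cst.
  by apply: cvgM; [exact: cvg_cst | exact: cvg_harmonic].
Unshelve. all: by end_near.
Qed.

End Construction.

Theorem corollary1 (R : realType) :
  [/\ (forall (n : nat) (w : 'I_n -> 'rV[R]_3),
         (3 <= n)%N -> polygons R n w ->
         max_defect w >= 2 * alpha R / n%:R),
      (fun n : nat => n%:R / (2 * alpha R) *
         inf [set max_defect w | w in polygons R n]) @ \oo --> (1 : R) &
      (forall (n : nat) (w : 'I_n -> 'rV[R]_3),
         (3 <= n)%N -> polygons R n w ->
         (max_defect w = 2 * alpha R / n%:R <->
          (4 %| n)%N /\
          exists v : 'I_4 -> 'rV[R]_3,
            [/\ injective v,
                centered_regular_tetrahedron v,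
                (forall i : 'I_n, exists k : 'I_4, w i = v k) &
                (forall k : 'I_4, #|[set i : 'I_n | w i == v k]%SET| = (n %/ 4)%N)]))].
Proof.
split; first exact: max_defect_lower_bound; first exact: inf_max_defect_cvg.
move=> n w n3 wP; split; first exact: extremal_polygon.
by move=> [_ [v [_ vt wv _]]]; apply: tetrahedral_polygon vt wv.
Qed.
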